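(* Let $\mathcal{D}\subset\mathbb{R}^{d_x}$ be a dataset with authentic data distribution $P_{\mathcal{D}}$, and let $\phi\in\mathbb{R}^{d_x}$ be a data-compliant key (so $\|\phi\|=1$ and $\phi^T x<0$ for $x\sim P_{\mathcal{D}}$). Let $\gamma>0$ and let the user-end model $G_\phi$ be characterized by $$G_\phi(z)=G_0(z)+\gamma\phi+\epsilon,\qquad z\sim P_z,\quad \epsilon\sim\mathcal{N}(\mu,\Sigma),$$ where the root model $G_0$ satisfies $P_{G_0}=P_{\mathcal{D}}$. Let $d_{\max}(\phi)=\max_{x\in\mathcal{D}}|\phi^T x|$, $\sigma^2(\phi)=\phi^T\Sigma\phi$ (with $\sigma(\phi)\ge 0$), and $\delta\in(0,1]$. If $$\gamma\ \ge\ d_{\max}(\phi)+\sigma(\phi)\sqrt{\log\left(\frac{1}{\delta^2}\right)}-\phi^T\mu,$$ then $D(G_\phi)\ge 1-\delta/2$.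
   Context: $\|\cdot\|$ is the Euclidean ($l_2$) norm. $P_{\mathcal{D}}$ is the distribution of the authentic data, which take values in $\mathcal{D}$. $P_z$ is a latent probability distribution on $\mathbb{R}^{d_z}$; $G_0:\mathbb{R}^{d_z}\to\mathbb{R}^{d_x}$ is the root generative model, and $P_{G_0}$ denotes the distribution of $G_0(z)$ for $z\sim P_z$. $P_{G_\phi}$ denotes the distribution of $G_\phi(z)=G_0(z)+\gamma\phi+\epsilon$. $\mathcal{N}(\mu,\Sigma)$ is the Gaussian distribution on $\mathbb{R}^{d_x}$ with mean $\mu$ and covariance matrix $\Sigma$. A key is a vector $\phi\in\mathbb{R}^{d_x}$ with $\|\phi\|=1$; it is data-compliant if $\phi^T x<0$ for $x\sim P_{\mathcal{D}}$. The binary linear classifier associated with $\phi$ is $f_\phi(x)=\mathrm{sign}(\phi^T x)$, where the label $1$ means that $x$ is attributed to $G_\phi$ and the label $-1$ means that it is not. The distinguishability of $G_\phi$ is $$D(G_\phi):=\frac12\,\mathbb{E}_{x\sim P_{G_\phi},\,x_0\sim P_{\mathcal{D}}}\left[\mathbb{1}(f_\phi(x)=1)+\mathbb{1}(f_\phi(x_0)=-1)\right],$$ where $\mathbb{1}$ is the indicator function. *)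

(* Defs.v *)
From HB Require Import structures.
From mathcomp Require Import all_boot all_order all_algebra.
From mathcomp Require Import all_classical all_reals all_analysis.
From mathcomp Require Import measurable_realfun.

Set Implicit Arguments.
Unset Strict Implicit.
Unset Printing Implicit Defensive.

Import Order.TTheory GRing.Theory Num.Theory.
Import numFieldNormedType.Exports.

Local Open Scope classical_set_scope.
Local Open Scope ring_scope.

(* R^n is [n.-tuple R] with its product sigma-algebra. *)

Definition dotp (R : realType) (n : nat) (x y : n.-tuple R) : R :=
  \sum_(i < n) tnth x i * tnth y i.

(* The library norm on vectors is the sup norm. *)
Definition l2norm (R : realType) (n : nat) (x : n.-tuple R) : R :=
  Num.sqrt (dotp x x).

Definition quad_form (R : realType) (n : nat) (Sigma : 'M[R]_n)
    (x : n.-tuple R) : R :=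
  \sum_(i < n) \sum_(j < n) tnth x i * Sigma i j * tnth x j.

Definition is_max (R : realType) (S : set R) (m : R) : Prop :=
  S m /\ ubound S m.

(* [normal_prob m 0] is, by convention, not a point mass but a uniform law, so
   the degenerate normal law needs a case of its own. *)
Definition normal_law (R : realType) (m s : R) (A : set R) : \bar R :=
  if s == 0 then \d_m A else normal_prob m s A.

(* N(mu, Sigma), possibly degenerate: all linear functionals are normally
   distributed, the mean vector is mu and the covariance matrix is Sigma. *)
Definition gaussian (R : realType) (n : nat)
    (P : probability (n.-tuple R) R) (mu : n.-tuple R) (Sigma : 'M[R]_n) :
    Prop :=
  [/\ (forall a : n.-tuple R, exists m s : R, 0 <= s /\
         forall A : set R, measurable A ->
           pushforward P (dotp a) A = normal_law m s A),
      (forall i : 'I_n,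
         ('E_P[fun x : n.-tuple R => tnth x i] = (tnth mu i)%:E)%E) &
      (forall i j : 'I_n,
         covariance P (fun x : n.-tuple R => tnth x i)
                      (fun x : n.-tuple R => tnth x j) = (Sigma i j)%:E)].

Definition is_key (R : realType) (n : nat) (phi : n.-tuple R) : Prop :=
  l2norm phi = 1.

Definition data_compliant (R : realType) (n : nat)
    (PD : probability (n.-tuple R) R) (phi : n.-tuple R) : Prop :=
  {ae PD, forall x, dotp phi x < 0}.

(* The classifier is binary, so 0 must be given one of the two labels: here 1. *)
Definition classifier (R : realType) (n : nat) (phi x : n.-tuple R) : int :=
  if 0 <= dotp phi x then 1 else -1.

Definition user_model (R : realType) (dz dx : nat)
    (G0 : {mfun dz.-tuple R >-> dx.-tuple R}) (gamma : R) (phi : dx.-tuple R)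
    (w : dz.-tuple R * dx.-tuple R) : dx.-tuple R :=
  [tuple tnth (G0 w.1) i + gamma * tnth phi i + tnth w.2 i | i < dx].

Section user_model_measurable.
Context (R : realType) (dz dx : nat).
Variables (G0 : {mfun dz.-tuple R >-> dx.-tuple R}) (gamma : R)
  (phi : dx.-tuple R).

Lemma measurable_user_model : measurable_fun setT (user_model G0 gamma phi).
Proof.
apply/measurable_fun_tnthP => i.
rewrite (_ : _ \o _ = fun w : dz.-tuple R * dx.-tuple R =>
  tnth (G0 w.1) i + gamma * tnth phi i + tnth w.2 i); last first.
  by apply/funext => w /=; rewrite tnth_mktuple.
apply: measurable_funD.
  apply: measurable_funD => //.
  apply: (measurableT_comp (measurable_tnth i)).
  by apply: measurableT_comp.
by apply: (measurableT_comp (measurable_tnth i)).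
Qed.

HB.instance Definition _ := isMeasurableFun.Build _ _ _ _
  (user_model G0 gamma phi) measurable_user_model.

End user_model_measurable.

(* The law of G_phi(z), where z ~ Pz and eps ~ Peps are independent. *)
Definition user_law (R : realType) (dz dx : nat)
    (Pz : probability (dz.-tuple R) R)
    (G0 : {mfun dz.-tuple R >-> dx.-tuple R}) (gamma : R) (phi : dx.-tuple R)
    (Peps : probability (dx.-tuple R) R) : probability (dx.-tuple R) R :=
  distribution (Pz \x Peps)%E (user_model G0 gamma phi).

Definition distinguishability (R : realType) (n : nat) (phi : n.-tuple R)
    (PG PD : probability (n.-tuple R) R) : \bar R :=
  (2^-1%:E * 'E_(PG \x PD)[fun w : n.-tuple R * n.-tuple R =>
     ((classifier phi w.1 == 1)%:R + (classifier phi w.2 == -1)%:R)%R])%E.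

(* Main.v *)
(* Write X = phi^T eps, which is normal with some mean m and deviation s, and
   t = sqrt (log (1 / delta^2)). On the almost sure event |phi^T G_0(z)| <= dmax
   the hypothesis on gamma makes a user sample correctly classified as soon as
   X >= phi^T mu - sigma(phi) t, and by Chernoff's bound this fails with
   probability at most exp (- t^2 / 2) = delta, provided that m = phi^T mu and
   s <= sigma(phi). Together with the authentic samples, which are almost surely
   correctly classified, this gives (1 - delta + 1) / 2.

   The parameters m and s are recovered from the first two moments of X. Both
   E[exp (u (X - m))] and E[exp (- a (X - m)^2)] are explicit, since these
   factors turn the normal density into a multiple of another normal density.
   The former and exp x >= 1 + x give E[X] = m; the latter and
   1 - exp (- x) <= x give Var X >= s^2. *)

Require Import Defs.
From HB Require Import structures.
From mathcomp Require Import all_boot all_order all_algebra.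
From mathcomp Require Import all_classical all_reals all_analysis.
From mathcomp Require Import measurable_realfun ring lra.

Import Order.TTheory GRing.Theory Num.Theory.
Import numFieldNormedType.Exports.

Local Open Scope classical_set_scope.
Local Open Scope ring_scope.

(** * Normal densities and their products with exponential factors *)

(** The Radon-Nikodym derivative of [normal_prob m s] and [normal_pdf m s] have the same integral
    over every measurable set, so they agree almost everywhere and can be exchanged under the
    integral. *)
Lemma integral_normal_prob (R : realType) (m s : R) (f : R -> \bar R) :
  measurable_fun setT f -> (forall x, 0 <= f x)%E ->
  (\int[normal_prob m s]_x f x =
   \int[lebesgue_measure]_x (f x * (normal_pdf m s x)%:E))%E.
Proof.
move=> mf f0; have dom := normal_prob_dominates m s.
rewrite -(Radon_Nikodym_SigmaFinite.change_of_variables dom)//.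
have iRN := Radon_Nikodym_SigmaFinite.f_integrable dom.
have mpdf : measurable_fun setT (fun x : R => (normal_pdf m s x)%:E).
  by apply/measurable_EFinP; exact: measurable_normal_pdf.
apply: ae_eq_integral => //.
- by apply: emeasurable_funM => //; exact: measurable_int iRN.
- exact: emeasurable_funM.
- apply: ae_eqe_mul2l; apply: integral_ae_eq => // E _ mE.
  by rewrite -Radon_Nikodym_SigmaFinite.f_integral.
Qed.

(** Completing the square: the tilt by [t] shifts the mean by [t * s ^+ 2]. *)
Lemma expR_normal_pdf (R : realType) (m s t x : R) : s != 0 ->
  expR (t * (x - m)) * normal_pdf m s x =
  expR (t ^+ 2 * s ^+ 2 / 2) * normal_pdf (m + t * s ^+ 2) s x.
Proof.
move=> s0; rewrite !normal_pdfE// /normal_fun.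
rewrite mulrCA -expRD [RHS]mulrCA -expRD; congr (_ * expR _).
by field.
Qed.

(** With [k = 1 + 2 * a * s ^+ 2], the exponents add up to [- k * (x - m) ^+ 2 / (2 * s ^+ 2)]: the
    variance is divided by [k]. The peak of the narrower density is [Num.sqrt k] times higher, which
    the leading factor compensates. *)
Lemma expRN_sqr_normal_pdf (R : realType) (m s a x : R) :
    s != 0 -> 0 <= a ->
  expR (- (a * (x - m) ^+ 2)) * normal_pdf m s x =
  (Num.sqrt (1 + 2 * a * s ^+ 2))^-1 *
    normal_pdf m (s / Num.sqrt (1 + 2 * a * s ^+ 2)) x.
Proof.
move=> s0 a0; set k := 1 + _.
have k0 : 0 < k.
  by rewrite /k ltr_wpDr// mulr_ge0 ?sqr_ge0// mulr_ge0.
have k0' : Num.sqrt k != 0 by rewrite gt_eqF// sqrtr_gt0.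
rewrite !normal_pdfE ?mulf_neq0 ?invr_eq0// /normal_fun /normal_peak.
have -> : (s / Num.sqrt k) ^+ 2 = s ^+ 2 / k.
  by rewrite expr_div_n sqr_sqrtr// ltW.
have -> : s ^+ 2 / k * pi *+ 2 = (s ^+ 2 * pi *+ 2) * k^-1.
  by rewrite mulrAC mulrnAl.
have A0 : 0 <= s ^+ 2 * pi *+ 2.
  by rewrite mulrn_wge0// mulr_ge0 ?sqr_ge0 ?pi_ge0.
set A := _ *+ 2 in A0 *.
rewrite (sqrtrM _ A0) sqrtrV ?ltW// invfM invrK.
rewrite -[in RHS]mulrA [in RHS](mulrCA (Num.sqrt A)^-1) mulKf//.
rewrite mulrCA -expRD; congr (_ * expR _).
by rewrite /k; field; rewrite s0 -/k gt_eqF.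
Qed.

(** * Threshold events and almost sure events *)

Lemma measurable_lt_cst d (T : measurableType d) (R : realType)
  (X : {mfun T >-> R}) (c : R) : measurable [set w | X w < c].
Proof.
rewrite (_ : [set _ | _] = X @^-1` `]-oo, c[); first exact: measurable_funPTI.
by apply/seteqP; split => w /=; rewrite in_itv.
Qed.

Lemma measurable_ge_cst d (T : measurableType d) (R : realType)
  (X : {mfun T >-> R}) (c : R) : measurable [set w | c <= X w].
Proof.
rewrite (_ : [set _ | _] = X @^-1` `[c, +oo[); first exact: measurable_funPTI.
by apply/seteqP; split => w /=; rewrite in_itv/= andbT.
Qed.

Lemma probability_ae1 d (T : measurableType d) (R : realType)
    (P : probability T R) (A : set T) :
  measurable A -> {ae P, forall x, A x} -> P A = 1%E.
Proof.
move=> mA aeA; rewrite -[A]setCK probability_setC; last exact: measurableC.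
rewrite (_ : P (~` A) = 0)%E ?sube0//.
by apply/negligibleP => //; exact: measurableC.
Qed.

(** * Moments and lower tail of a normally distributed random variable *)

Section normal_law_rv.
Context d (T : measurableType d) (R : realType) (P : probability T R).
Variables (X : {RV P >-> R}) (m s : R).
Hypothesis X_law : forall A : set R, measurable A ->
  pushforward P X A = normal_law m s A.

Lemma integral_normal_law (f : R -> R) :
    measurable_fun setT f -> (forall x, 0 <= f x) ->
  (\int[P]_w (f (X w))%:E = if (s == 0)%R then (f m)%:E
    else \int[lebesgue_measure]_x (f x * normal_pdf m s x)%:E)%E.
Proof.
move=> mf f0; have mf' := measurableT_comp (@EFin_measurable R _) mf.
(* [normal_prob] lives on [measurableTypeR R], whose display is not R's. *)
have mX : measurable_fun setT (X : T -> measurableTypeR R).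
  by move=> _ A mA; exact: (@measurable_funPT _ _ _ _ X measurableT A mA).
rewrite -[LHS](@ge0_integral_pushforward _ _ _ (measurableTypeR R) _ _ mX P setT
  (EFin \o f))//=; last by move=> x _; rewrite lee_fin.
move: X_law; rewrite /normal_law; case: eqP => _ XE /=.
  rewrite [LHS](eq_measure_integral
    (\d_(m : measurableTypeR R) : measure _ R)) => [|A mA _]; last exact: XE.
  by rewrite integral_dirac// diracT mul1e.
rewrite [LHS](eq_measure_integral (normal_prob m s)) => [|A mA _].
  by rewrite integral_normal_prob//; under eq_integral do rewrite EFinM.
exact: XE.
Qed.

(** This moment generating function serves three times: for square-integrability, for the mean and
    in Chernoff's bound. *)
Lemma expectation_expR_normal_law t :
  ('E_P[fun w => expR (t * (X w - m))%R] = (expR (t ^+ 2 * s ^+ 2 / 2))%:E)%E.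
Proof.
rewrite unlock (integral_normal_law (fun x => expR (t * (x - m))))//.
  have [->|s0] := eqVneq s 0.
    by rewrite subrr expr0n/= !(mulr0, mul0r).
  under eq_integral do rewrite expR_normal_pdf// EFinM.
  rewrite ge0_integralZl//= ?integral_normal_pdf ?mule1//.
    by apply/measurable_EFinP; exact: measurable_normal_pdf.
  by move=> x _; rewrite lee_fin normal_pdf_ge0.
apply: measurableT_comp => //; apply: measurable_funM => //.
exact: measurable_funB.
Qed.

Lemma expectation_expRN_sqr_normal_law a : 0 <= a ->
  ('E_P[fun w => expR (- (a * (X w - m) ^+ 2))%R] =
  ((Num.sqrt (1 + 2 * a * s ^+ 2))^-1)%:E)%E.
Proof.
move=> a0.
rewrite unlock (integral_normal_law (fun x => expR (- (a * (x - m) ^+ 2))))//.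
  have [->|s0] := eqVneq s 0.
    by rewrite subrr expr0n/= !(mulr0, oppr0, addr0) expR0 sqrtr1 invr1.
  under eq_integral do rewrite expRN_sqr_normal_pdf// EFinM.
  rewrite ge0_integralZl//= ?integral_normal_pdf ?mule1//.
    by apply/measurable_EFinP; exact: measurable_normal_pdf.
  by move=> x _; rewrite lee_fin normal_pdf_ge0.
apply: measurableT_comp => //; apply: measurableT_comp => //.
by apply: measurable_funM => //; apply: measurable_funX; exact: measurable_funB.
Qed.

Let Y w := X w - m.

Let mY : measurable_fun setT Y.
Proof. exact: measurable_funB. Qed.

Let integrable_expR t : P.-integrable setT (fun w => (expR (t * Y w))%:E).
Proof.
apply/integrableP; split.
  by apply/measurable_EFinP/measurableT_comp => //; exact: measurable_funM.
under eq_integral do rewrite gee0_abs ?lee_fin ?expR_ge0//.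
by have := expectation_expR_normal_law t; rewrite unlock => ->; rewrite ltry.
Qed.

(** Square-integrability follows from [y ^+ 2 <= 2 * expR |y| <= 2 * (expR y + expR (- y))], whose
    right-hand side is integrable at [y = Y w]. *)
Let Y2 : Y \in Lfun P 2%:E.
Proof.
rewrite inE; apply/andP; split; rewrite inE//= /finite_norm unlock/=.
apply: poweR_lty.
apply: (@le_lt_trans _ _ (\int[P]_w (2%:E *
    ((expR (1 * Y w))%:E + (expR (- 1 * Y w))%:E)))%E).
  apply: ge0_le_integral => //.
  - apply/measurable_EFinP.
    apply: (@measurableT_comp _ _ _ _ _ _ (fun x : R => x `^ 2)) => //.
    exact: measurableT_comp.
  - apply/measurable_EFinP; apply: measurable_funM => //.
    by apply: measurable_funD; apply: measurableT_comp => //;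
      exact: measurable_funM.
  - move=> w _; rewrite -EFinD -EFinM lee_fin.
    rewrite powR_mulrn// real_normK ?num_real//.
    rewrite mul1r mulN1r; have sq (x : R) : 0 <= x -> x ^+ 2 <= 2 * expR x.
      move=> x0; have := expR_ge1Dxn 1 x0.
      rewrite (_ : 2`! = 2)%N//; lra.
    have := sq `|Y w| (normr_ge0 _); rewrite real_normK ?num_real//.
    have := expR_gt0 (Y w); have := expR_gt0 (- Y w).
    by case: (ger0P (Y w)); lra.
rewrite integralZl//=; last by apply: integrableD.
rewrite integralD// lte_mul_pinfty//.
by rewrite lte_add_pinfty//; apply: integrable_lty.
Qed.

Lemma Lfun2_normal_law : (X : T -> R) \in Lfun P 2%:E.
Proof.
rewrite (_ : (X : T -> R) = Y + cst m).
  by apply: rpredD => [|h12|h12] //; [rewrite lee1n|exact: Lfun_cst].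
by apply/funext => w; rewrite !fctE subrK.
Qed.

Let Y1 : Y \in Lfun P 1.
Proof. by apply: Lfun_subset12 => //; exact: fin_num_measure. Qed.

(* Jensen's inequality for exp: its tangent at t * E[Y] is integrated. *)
Let expectation_center_le t :
  t * fine ('E_P[Y])%E <= t ^+ 2 * s ^+ 2 / 2.
Proof.
set u := fine _; set c := t * u.
rewrite -ler_expR -lee_fin.
rewrite -[leRHS](expectation_expR_normal_law t).
have -> : ((expR c)%:E =
    'E_P[(cst (expR c * (1 - c)) \+ (expR c * t) \o* Y)%R])%E.
  rewrite expectationD ?Lfun_cst ?Lfun_scale// expectation_cst expectationZl//.
  rewrite -[('E_P[Y])%E]fineK ?expectation_fin_num// -/u -EFinM -EFinD.
  by rewrite /c; congr EFin; ring.
rewrite unlock; apply: le_integral => //.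
  by apply/Lfun1_integrable; rewrite rpredD ?Lfun_cst ?Lfun_scale.
move=> w _; rewrite lee_fin /=.
have := expR_ge1Dx (t * Y w - c); rewrite expRD expRN ler_pdivlMr ?expR_gt0//.
by apply: le_trans; rewrite le_eqVlt; apply/orP; left; apply/eqP; ring.
Qed.

Lemma expectation_normal_law : ('E_P[X] = m%:E)%E.
Proof.
have Y0 : ('E_P[Y] = 0)%E.
  rewrite -[LHS]fineK ?expectation_fin_num//; congr EFin.
  (* With [u] the mean of [Y], the bound [t * u <= t ^+ 2 * s ^+ 2 / 2] for small [t] of the sign of
     [u] forces [u = 0]. This choice of [t] is small enough, and the [+ 1] keeps it meaningful when
     [s = 0]. *)
  have := expectation_center_le (fine ('E_P[Y])%E / (s ^+ 2 + 1)).
  set u := fine _ => h.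
  have s1 : 0 < s ^+ 2 + 1 by rewrite ltr_wpDl// sqr_ge0.
  apply/eqP; rewrite -sqrf_eq0 eq_le sqr_ge0 andbT.
  have := ler_wpM2r (ltW (mulr_gt0 s1 s1)) h.
  have -> : u / (s ^+ 2 + 1) * u * ((s ^+ 2 + 1) * (s ^+ 2 + 1)) =
    u ^+ 2 * (s ^+ 2 + 1) by field; rewrite gt_eqF.
  have -> : (u / (s ^+ 2 + 1)) ^+ 2 * s ^+ 2 / 2 *
      ((s ^+ 2 + 1) * (s ^+ 2 + 1)) =
    u ^+ 2 * s ^+ 2 / 2 by field; rewrite gt_eqF.
  by have := sqr_ge0 u; have := sqr_ge0 s; nra.
have -> : (X : T -> R) = (Y \+ cst m)%R by apply/funext => w /=; rewrite subrK.
by rewrite expectationD// ?Lfun_cst// Y0 expectation_cst add0e.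
Qed.

(** One inequality suffices, because the tail bound below is stated for any [sigma] above [s]. *)
Lemma variance_normal_law_ge : ((s ^+ 2)%:E <= variance P X)%E.
Proof.
rewrite /variance.
have VE : (covariance P X X = 'E_P[(Y ^+ 2)%R])%E.
  rewrite unlock expectation_normal_law/=; congr expectation.
have iY2 := Lfun2_integrable_sqr Y2.
have Vfin : ('E_P[(Y ^+ 2)%R] \is a fin_num)%E.
  by apply: expectation_fin_num; apply/Lfun1_integrable.
rewrite VE -(fineK Vfin) lee_fin; set v := fine _.
have v0 : 0 <= v by apply/fine_ge0/expectation_ge0 => w; exact: sqr_ge0.
(* The claim is the limit of this inequality as [a] tends to 0. It comes from integrating
   [1 <= expR (- (a * Y ^+ 2)) + a * Y ^+ 2]. *)
have key a : 0 < a -> s ^+ 2 <= v * (1 + 2 * a * s ^+ 2).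
  move=> a0; set k := 1 + _.
  have k1 : 1 <= k by rewrite lerDl mulr_ge0 ?sqr_ge0// mulr_ge0// ltW.
  have q1 : 1 <= Num.sqrt k by rewrite -sqrtr1 ler_wsqrtr.
  have : (1 <= (Num.sqrt k)^-1%:E + a%:E * v%:E)%E.
    rewrite /k -expectation_expRN_sqr_normal_law ?(ltW a0)// fineK// unlock.
    rewrite -ge0_integralZl//; last 3 first.
    - exact: measurable_int iY2.
    - by move=> w _; rewrite lee_fin sqr_ge0.
    - by rewrite lee_fin ltW.
    rewrite -ge0_integralD//; last 3 first.
    - apply/measurable_EFinP; apply: measurableT_comp => //.
      apply: measurableT_comp => //; apply: measurable_funM => //.
      exact: measurable_funX.
    - by move=> w _; rewrite -EFinM lee_fin mulr_ge0 ?sqr_ge0// ltW.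
    - apply: emeasurable_funM => //; exact: measurable_int iY2.
    rewrite -[leLHS](expectation_cst P 1) unlock.
    apply: ge0_le_integral => //.
    - by apply/measurable_EFinP.
    - apply: emeasurable_funD.
      + apply/measurable_EFinP; apply: measurableT_comp => //.
        apply: measurableT_comp => //; apply: measurable_funM => //.
        exact: measurable_funX.
      + by apply: emeasurable_funM => //; exact: measurable_int iY2.
    - move=> w _; rewrite -EFinM -EFinD lee_fin.
      have := expR_ge1Dx (- (a * (X w - m) ^+ 2)).
      by rewrite lerBlDr.
  rewrite -EFinM -EFinD lee_fin => h.
  have kE : Num.sqrt k ^+ 2 = k by rewrite sqr_sqrtr// (le_trans ler01).
  move: h q1 kE; set q := Num.sqrt k => h q1 kE.
  have q0 : 0 < q by apply: lt_le_trans q1.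
  have {}h : q <= 1 + a * v * q.
    have := ler_wpM2r (ltW q0) h.
    by rewrite mul1r mulrDl mulVf// gt_eqF.
  rewrite -kE -(ler_pM2l a0).
  (* The factor [q + 1] turns the left side into [k - 1 = 2 * a * s ^+ 2]; on the right,
     [q + 1 <= 2 * q] produces [2 * a * v * k]. *)
  have h1 : (q - 1) * (q + 1) <= a * v * q * (q + 1).
    by apply: ler_wpM2r; lra.
  have h2 : a * v * q * (q + 1) <= a * v * q * (q * 2).
    by apply: ler_wpM2l; [rewrite !mulr_ge0// ltW|lra].
  move: kE h1 h2; rewrite /k; nra.
rewrite leNgt; apply/negP => vs.
have s0 : 0 < s ^+ 2 by exact: le_lt_trans vs.
(* An explicit [a] replaces the limit: it makes the right side of [key] at most
   [v + (s ^+ 2 - v) / 2], which is less than [s ^+ 2]. The [v + 1] avoids dividing by zero when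
   [v = 0]. *)
have a0 : 0 < (s ^+ 2 - v) / (4 * s ^+ 2 * (v + 1)).
  by apply: divr_gt0; [rewrite subr_gt0|apply: mulr_gt0; lra].
have sn0 : s != 0 by rewrite -sqrf_eq0 gt_eqF.
have v1 : v + 1 != 0 by rewrite gt_eqF// ltr_wpDl.
have := key _ a0.
have -> : v * (1 + 2 * ((s ^+ 2 - v) / (4 * s ^+ 2 * (v + 1))) * s ^+ 2) =
  v + (s ^+ 2 - v) * (v / (v + 1)) / 2.
  by field; rewrite sn0 v1.
have : v / (v + 1) <= 1 by rewrite ler_pdivrMr ?ltr_wpDl//; lra.
have : 0 <= v / (v + 1) by rewrite divr_ge0// ltW// ltr_wpDl.
nra.
Qed.

Lemma normal_law_lower_tail (sigma t : R) : 0 <= s -> s <= sigma -> 0 <= t ->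
  (P [set w | X w < m - sigma * t]%R <= (expR (- (t ^+ 2 / 2)))%:E)%E.
Proof.
(* Chernoff's bound will be used with parameter [t / s], which must be positive. For [t = 0] the
   bound is 1, and for [s = 0] the law is a point mass at [m], outside the event. *)
move=> s0 s_sigma; rewrite le_eqVlt => /predU1P[<-|t0].
  rewrite expr0n/= mul0r oppr0 expR0 probability_le1//.
  exact: measurable_lt_cst.
have [s_eq0|s_neq0] := eqVneq s 0.
  have -> : (P [set w | X w < m - sigma * t]%R = 0)%E; last first.
    by rewrite lee_fin expR_ge0.
  rewrite -[LHS]/(pushforward P X [set x | x < m - sigma * t]%R) X_law.
    rewrite /normal_law s_eq0 eqxx diracE memNset//= ltNge lerBlDr lerDl.
    by rewrite mulr_ge0 ?(ltW t0)// (le_trans s0).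
  by rewrite (_ : [set _ | _] = `]-oo, m - sigma * t[%classic)// set_itvE.
have {s_neq0}s0 : 0 < s by rewrite lt_def s_neq0.
pose Z : {RV P >-> R} := (cst m - X)%R.
apply: (@le_trans _ _ (P [set w | Z w >= s * t]%R)).
  apply: le_measure; rewrite ?inE.
  - exact: measurable_lt_cst.
  - exact: measurable_ge_cst.
  - move=> w /= h; rewrite -[leRHS]/(m - X w).
    by have := ler_wpM2r (ltW t0) s_sigma; lra.
(* The parameter [r = t / s] minimises the exponent [r ^+ 2 * s ^+ 2 / 2 - r * s * t], with value
   [- t ^+ 2 / 2]. *)
apply: (le_trans (chernoff _ _ (divr_gt0 t0 s0))).
rewrite /mmt_gen_fun (_ : expR \o _ = fun w => expR (- (t / s) * (X w - m))).
  rewrite expectation_expR_normal_law -EFinM lee_fin -expRD ler_expR.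
  rewrite le_eqVlt; apply/orP; left; apply/eqP; field.
  by rewrite gt_eqF.
apply/funeqP => w /=; congr expR.
by rewrite -[LHS]/((m - X w) * (t / s)); ring.
Qed.

End normal_law_rv.

(** * Moments of finite linear combinations of square-integrable variables *)

Section sum_scale.
Context d (T : measurableType d) (R : realType) (P : probability T R).
Variables (I : Type) (a : I -> R) (X : I -> T -> R).

Lemma Lfun_sum_scale (r : seq I) : (forall i, X i \in Lfun P 2%:E) ->
  (fun x => \sum_(i <- r) a i * X i x) \in Lfun P 2%:E.
Proof.
move=> X2; elim: r => [|i r IHr].
  by under eq_fun do rewrite big_nil; exact: Lfun_cst.
rewrite (_ : (fun x => _) =
    (a i \o* X i) + (fun x => \sum_(j <- r) a j * X j x)); last first.
  by apply/funext => x; rewrite big_cons !fctE/= mulrC.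
by apply: rpredD => [|h12|h12] //; [rewrite lee1n|exact: Lfun_scale].
Qed.

Lemma expectation_sum_scale (r : seq I) : (forall i, X i \in Lfun P 2%:E) ->
  ('E_P[fun x => (\sum_(i <- r) a i * X i x)%R] =
   \sum_(i <- r) (a i)%:E * 'E_P[X i])%E.
Proof.
move=> X2; have Pfin : P setT \is a fin_num by exact: fin_num_measure.
elim: r => [|i r IHr].
  by rewrite big_nil; under eq_fun do rewrite big_nil; exact: expectation_cst.
rewrite big_cons -IHr -expectationZl ?Lfun_subset12//.
rewrite -expectationD ?Lfun_scale ?Lfun_subset12 ?Lfun_sum_scale//.
by congr expectation; apply/funext => x; rewrite big_cons/= mulrC.
Qed.

Lemma covariance_sum_scalel (r : seq I) (Z : T -> R) :
    (forall i, X i \in Lfun P 2%:E) -> Z \in Lfun P 2%:E ->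
  (covariance P (fun x => \sum_(i <- r) a i * X i x)%R Z =
   \sum_(i <- r) (a i)%:E * covariance P (X i) Z)%E.
Proof.
move=> X2 Z2; have Pfin : P setT \is a fin_num by exact: fin_num_measure.
elim: r => [|i r IHr].
  by rewrite big_nil; under eq_fun do rewrite big_nil; exact: covariance_cst_l.
have L21 := Lfun_subset12 Pfin.
rewrite big_cons -IHr -covarianceZl; last 3 first.
- exact: L21.
- exact: L21.
- exact: Lfun2_mul_Lfun1.
rewrite -covarianceDl ?Lfun_scale ?Lfun_sum_scale// ?ler1n//.
by congr (covariance _ _ _); apply/funext => x; rewrite big_cons/= mulrC.
Qed.

End sum_scale.

(** * Linear functionals of a Gaussian vector *)

Section measurable_dotp.
Context (R : realType) (n : nat) (a : n.-tuple R).

Lemma measurable_dotp : measurable_fun setT (dotp (R := R) a).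
Proof.
apply: measurable_sum => i; apply: measurable_funM => //.
exact: measurable_tnth.
Qed.

HB.instance Definition _ := isMeasurableFun.Build _ _ _ _
  (dotp (R := R) a) measurable_dotp.

End measurable_dotp.

Section gaussian_dotp.
Context (R : realType) (n : nat) (P : probability (n.-tuple R) R).
Variables (mu : n.-tuple R) (Sigma : 'M[R]_n).
Hypothesis P_gauss : gaussian P mu Sigma.

Lemma gaussian_dotp_Lfun2 (a : n.-tuple R) : dotp a \in Lfun P 2%:E.
Proof.
by case: P_gauss => law _ _; have [m [s [_ /Lfun2_normal_law]]] := law a.
Qed.

(** A coordinate is the functional of a basis vector, hence normal. This provides the integrability
    needed to expand moments by linearity. *)
Lemma gaussian_tnth_Lfun2 (i : 'I_n) :
  (fun x : n.-tuple R => tnth x i) \in Lfun P 2%:E.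
Proof.
have -> : (fun x : n.-tuple R => tnth x i) = dotp [tuple (j == i)%:R | j < n].
  apply/funext => x; rewrite /dotp (bigD1 i)//= tnth_mktuple eqxx mul1r.
  by rewrite big1 ?addr0// => j /negbTE ji; rewrite tnth_mktuple ji mul0r.
exact: gaussian_dotp_Lfun2.
Qed.

Lemma gaussian_dotp_expectation (a : n.-tuple R) :
  ('E_P[dotp a] = (dotp a mu)%:E)%E.
Proof.
case: P_gauss => _ mean _.
rewrite /dotp expectation_sum_scale; last exact: gaussian_tnth_Lfun2.
by rewrite -sumEFin; apply: eq_bigr => i _; rewrite mean.
Qed.

(** Bilinearity of the covariance. Being a variance, [quad_form Sigma a] is nonnegative, so its
    [Num.sqrt] is a genuine standard deviation and not the default value 0. *)
Lemma gaussian_dotp_variance (a : n.-tuple R) :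
  (variance P (dotp a) = (quad_form Sigma a)%:E)%E.
Proof.
case: P_gauss => _ _ cov; have L2 := gaussian_tnth_Lfun2.
rewrite /variance {1}/dotp covariance_sum_scalel ?gaussian_dotp_Lfun2//.
rewrite /quad_form -sumEFin; apply: eq_bigr => i _.
have -> : covariance P (fun x : n.-tuple R => tnth x i) (dotp a) =
    (\sum_(j < n) Sigma i j * tnth a j)%:E.
  rewrite covarianceC /dotp covariance_sum_scalel// -sumEFin.
  by apply: eq_bigr => j _; rewrite covarianceC cov -EFinM mulrC.
by rewrite -EFinM mulr_sumr; congr EFin; apply: eq_bigr => j _; rewrite mulrA.
Qed.

Lemma gaussian_dotp_lower_tail (a : n.-tuple R) (t : R) : 0 <= t ->
  (P [set x | (dotp a x < dotp a mu - Num.sqrt (quad_form Sigma a) * t)%R]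
     <= (expR (- (t ^+ 2 / 2)))%:E)%E.
Proof.
move=> t0; case: (P_gauss) => law _ _; have [m [s [s0 X_law]]] := law a.
have -> : dotp a mu = m.
  apply: EFin_inj; rewrite -gaussian_dotp_expectation.
  by rewrite (expectation_normal_law _ _ _ _ _ _ _ X_law).
apply: (normal_law_lower_tail _ _ _ _ _ _ _ X_law) => //.
have := variance_normal_law_ge _ _ _ _ _ _ _ X_law.
rewrite gaussian_dotp_variance lee_fin => /ler_wsqrtr.
by rewrite sqrtr_sqr ger0_norm.
Qed.

End gaussian_dotp.

(** * Distinguishability of the user model *)

(** Each indicator depends on one component only, so it is the indicator of a cylinder, whose
    product measure is that of its base. *)
Lemma distinguishabilityE (R : realType) (n : nat) (phi : n.-tuple R)
    (PG PD : probability (n.-tuple R) R) :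
  (distinguishability phi PG PD = 2^-1%:E *
     (PG [set x | (0 <= dotp phi x)%R] + PD [set x | (dotp phi x < 0)%R]))%E.
Proof.
set A := [set x | (0 <= dotp phi x)%R]; set B := [set x | (dotp phi x < 0)%R].
have mA : measurable A by exact: measurable_ge_cst.
have mB : measurable B by exact: measurable_lt_cst.
congr (_ * _)%E; rewrite unlock.
under eq_integral => w _.
  have -> : (classifier phi w.1 == 1)%:R + (classifier phi w.2 == -1)%:R =
      \1_(A `*` setT) w + \1_(setT `*` B) w :> R.
    rewrite !indicE; congr (_%:R + _%:R).
      rewrite /classifier; apply/esym; have [h|h] := leP 0 (dotp phi w.1).
        by rewrite mem_set.
      by rewrite memNset//= => -[]; rewrite /A/= leNgt h.
    rewrite /classifier; apply/esym; have [h|h] := leP 0 (dotp phi w.2).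
      by rewrite memNset//= => -[]; rewrite /B/= ltNge h.
    by rewrite mem_set.
  rewrite EFinD; over.
have mAT : measurable (A `*` [set: n.-tuple R]) by exact: measurableX.
have mTB : measurable ([set: n.-tuple R] `*` B) by exact: measurableX.
rewrite ge0_integralD//; last 2 first.
- by apply/measurable_EFinP; exact: measurable_indic.
- by apply/measurable_EFinP; exact: measurable_indic.
rewrite !integral_indic// !setIT.
congr (_ + _)%E.
  by rewrite -[RHS]mule1 -(probability_setT PD); exact: product_measure1E.
by rewrite -[RHS]mul1e -(probability_setT PG); exact: product_measure1E.
Qed.

Theorem theorem1 (R : realType) (dz dx : nat)
    (D : set (dx.-tuple R)) (PD : probability (dx.-tuple R) R)
    (Pz : probability (dz.-tuple R) R)
    (G0 : {mfun dz.-tuple R >-> dx.-tuple R})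
    (phi mu : dx.-tuple R) (Sigma : 'M[R]_dx)
    (Peps : probability (dx.-tuple R) R) (gamma dmax delta : R)
    (D_PD : {ae PD, forall x, D x})
    (key_phi : is_key phi)
    (compliant_phi : data_compliant PD phi)
    (gamma_gt0 : 0 < gamma)
    (eps_gauss : gaussian Peps mu Sigma)
    (PG0_PD : forall A : set (dx.-tuple R), measurable A ->
       distribution Pz G0 A = PD A)
    (dmaxE : is_max [set `|dotp phi x| | x in D] dmax)
    (delta_gt0 : 0 < delta) (delta_le1 : delta <= 1)
    (gamma_ge : dmax
        + Num.sqrt (quad_form Sigma phi) * Num.sqrt (ln (1 / delta ^+ 2))
        - dotp phi mu <= gamma) :
  ((1 - delta / 2)%:E
     <= distinguishability phi (user_law Pz G0 gamma phi Peps) PD)%E.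
Proof.
set sigma := Num.sqrt (quad_form Sigma phi) in gamma_ge *.
set t := Num.sqrt (ln (1 / delta ^+ 2)) in gamma_ge *.
have t0 : 0 <= t by rewrite sqrtr_ge0.
have delta_t : expR (- (t ^+ 2 / 2)) = delta.
  rewrite /t; have -> : ln (1 / delta ^+ 2) = - (ln delta *+ 2).
    by rewrite div1r lnV ?posrE ?exprn_gt0// lnXn.
  (* The radicand is nonnegative because [delta <= 1]; a negative one would make [t] equal to 0. *)
  rewrite sqr_sqrtr.
    by rewrite (_ : - (_ / 2) = ln delta); [rewrite lnK ?posrE|field].
  by rewrite oppr_ge0 mulrn_wle0// ln_le0.
pose A := [set x : dx.-tuple R | 0 <= dotp phi x].
pose K := [set x : dx.-tuple R | - dmax <= dotp phi x].
pose E := [set e : dx.-tuple R | dotp phi mu - sigma * t <= dotp phi e].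
have mA : measurable A by exact: measurable_ge_cst.
have mK : measurable K by exact: measurable_ge_cst.
have mE : measurable E by exact: measurable_ge_cst.
have phi1 : dotp phi phi = 1.
  have := key_phi; rewrite /is_key /l2norm => /(congr1 (fun r => r ^+ 2)).
  by rewrite expr1n sqr_sqrtr// /dotp sumr_ge0// => i _; exact: sqr_ge0.
have PDK : PD K = 1%E.
  apply: probability_ae1 => //; apply: filterS D_PD => x Dx.
  have /ler_normlP[] : `|dotp phi x| <= dmax by apply: dmaxE.2; exists x.
  by rewrite /K/= lerNl.
have PE : ((1 - delta)%:E <= Peps E)%E.
  have -> : E = ~` [set e | dotp phi e < dotp phi mu - sigma * t].
    by apply/seteqP; split => e /=; rewrite /E/= leNgt => /negP.
  rewrite probability_setC; last exact: measurable_lt_cst.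
  rewrite EFinB leeB// -delta_t.
  exact: gaussian_dotp_lower_tail.
have PG : ((1 - delta)%:E <= user_law Pz G0 gamma phi Peps A)%E.
  apply: (le_trans PE).
  have mGK : measurable (G0 @^-1` K) by exact: measurable_funPTI.
  (* By independence the rectangle has the product of the two probabilities, and the first is
     [PD K = 1] since [G0] has law [PD]. *)
  have <- : ((Pz \x Peps) ((G0 @^-1` K) `*` E) = Peps E)%E.
    by rewrite -[RHS]mul1e -PDK -(PG0_PD _ mK); exact: product_measure1E.
  apply: le_measure; rewrite ?inE.
  - exact: measurableX.
  - exact: measurable_funPTI.
  - move=> w [/= h1 h2]; rewrite /A/=.
    have -> : dotp phi (user_model G0 gamma phi w) =
        dotp phi (G0 w.1) + gamma * dotp phi phi + dotp phi w.2.
      rewrite /dotp mulr_sumr -!big_split/=; apply: eq_bigr => i _.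
      by rewrite tnth_mktuple; ring.
    (* The lower bounds given by [K] and [E] add up with [gamma] to a nonnegative number: this is
       exactly [gamma_ge]. *)
    rewrite phi1; move: h1 h2; rewrite /K /E/=; lra.
have PDB : PD [set x | dotp phi x < 0] = 1%E.
  by apply: probability_ae1 => //; exact: measurable_lt_cst.
rewrite distinguishabilityE PDB.
apply: (@le_trans _ _ (2^-1%:E * ((1 - delta)%:E + 1))%E).
  by rewrite -EFinD -EFinM lee_fin; lra.
by apply: lee_wpmul2l; [rewrite lee_fin invr_ge0|rewrite leeD2r].
Qed.
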